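(* For every fixed $k\in\mathbb{N}$, the values $\tau_{n,k}$ decrease strictly in $n$: $$\tau_{n+1,k}<\tau_{n,k}<\cdots<\tau_{k+3,k}<\tau_{k+2,k}\qquad (n\ge k+2).$$ In particular, for every fixed $k\in\mathbb{N}$ and every $m\ge 2$, $\tau_{n,k}\le\tau_{k+m,k}$ for all $n\ge k+m$.
   Context: $T_n$ denotes the Chebyshev polynomial of the first kind of degree $n$, $T_n(\cos\theta)=\cos n\theta$. For integers $n\ge k+2$, $k\ge 1$, let $\omega_{n,k}$ be the rightmost (largest) zero of $T_n^{(k+1)}$ and define $\tau_{n,k}:=|T_n^{(k)}(\omega_{n,k})|/T_n^{(k)}(1)$. *)

(* Defs.v *)
From mathcomp Require Import all_boot all_order all_algebra.
From mathcomp Require Import boolp classical_sets reals.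
Set Implicit Arguments. Unset Strict Implicit. Unset Printing Implicit Defensive.
Import Order.TTheory GRing.Theory Num.Theory.
Local Open Scope ring_scope.

(* Chebyshev polynomials of the first kind: T_0 = 1, T_1 = X,
   T_{n+2} = 2 X T_{n+1} - T_n  (the characterization T_n(cos t) = cos (n t)). *)
Fixpoint cheb_pair (R : realType) (n : nat) : {poly R} * {poly R} :=
  match n with
  | 0 => (1, 'X)
  | m.+1 => let p := cheb_pair R m in (p.2, 2%:P * 'X * p.2 - p.1)
  end.

Definition chebT (R : realType) (n : nat) : {poly R} := (cheb_pair R n).1.

(* omega_{n,k}: the largest real zero of T_n^{(k+1)} (chosen by xget; it exists
   and is unique whenever n >= k+2). *)
Definition is_rightmost_root (R : realType) (p : {poly R}) (x : R) : Prop :=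
  root p x /\ (forall y : R, root p y -> y <= x).

Definition omega (R : realType) (n k : nat) : R :=
  xget 0 [set x | is_rightmost_root (chebT R n)^`(k.+1) x].

Definition tau (R : realType) (n k : nat) : R :=
  `|((chebT R n)^`(k)).[omega R n k]| / ((chebT R n)^`(k)).[1].

(* Main.v *)
(**
Write f = T_n^(k), g = T_(n+1)^(k) and let w_n be the rightmost zero of f'.
The function F = (n+k)^2 f^2 + (1-x^2) f'^2 equals ((n+k) f)^2 at w_n. The
first-order relations between f, f', g, g' show that F is proportional to g^2
at w_(n+1), with exactly the factor that turns F(w_(n+1)) < F(w_n) into
tau_(n+1,k) < tau_(n,k), and that F' is a positive multiple of f' g'. On
(w_n, w_(n+1)) one has f' > 0. The Wronskian g'' f' - g' f'' is positive (by
induction on n, from the three-term recurrence of the f'), so every zero of g'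
to the right of w_n is an upward crossing; hence g' < 0 on (w_n, w_(n+1)), and
F decreases there.
*)
Require Import Defs.
From mathcomp Require Import all_boot all_order all_algebra.
From mathcomp Require Import boolp classical_sets reals.
From mathcomp Require Import ring lra.
From mathcomp Require Import polyrcf.
Import Order.TTheory GRing.Theory Num.Theory.
Local Open Scope ring_scope.

(** * Zeros and signs of polynomials over a real closed field *)

Section RealClosed.
Set Implicit Arguments. Unset Strict Implicit.
Variable R : rcfType.
Implicit Types (p : {poly R}) (a b u : R).

(** Dividing out the zero at b, and the one at u if present, turns the slopes there into endpoint
    values of the quotient. These have opposite signs, so the intermediate value theorem applies to
    the quotient. *)
Lemma root_between_increasing_roots p u b :
  u < b -> root p b -> 0 < p^`().[b] -> 0 <= p.[u] ->
  (root p u -> 0 < p^`().[u]) -> exists2 v, u < v < b & root p v.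
Proof.
move=> ub /factor_theorem[q ->]; rewrite derivM derivXsubC !hornerE subrr.
rewrite mulr0 add0r => qb pu dpu.
have qu0 : q.[u] <= 0 by nra.
have [qu|qu] := boolP (root q u); last first.
  have [] := @poly_ivtoo _ q u b (ltW ub).
    by rewrite pmulr_llt0 // lt_neqAle qu0 andbT.
  by move=> v /=; rewrite in_itv /= => uvb qv; exists v => //; rewrite rootM qv.
move: qu dpu => /factor_theorem[s qE].
rewrite {}qE in qb pu qu0 *.
rewrite rootM rootM root_XsubC eqxx orbT derivM derivXsubC !hornerE.
rewrite !subrr !mulr0 add0r addr0 => /(_ isT) su.
move: qb; rewrite !hornerE => sb.
have [] := @poly_ivtoo _ s u b (ltW ub).
  have ? : 0 < s.[b] by nra.
  have ? : s.[u] < 0 by nra.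
  by nra.
by move=> v /=; rewrite in_itv /= => uvb sv; exists v => //; rewrite !rootM sv.
Qed.

(** Two consecutive zeros cannot both be upward crossings. If p were nonnegative at u, the last zero
    before b, or u itself if there is none, would force a further zero below b. *)
Lemma lt0_left_of_increasing_root p a b :
  root p b -> (forall z, a < z <= b -> root p z -> 0 < p^`().[z]) ->
  forall u, a < u < b -> p.[u] < 0.
Proof.
move=> pb dp u /andP[au ub]; rewrite ltNge; apply/negP => pu0.
have ab := lt_trans au ub.
have dpb : 0 < p^`().[b] by rewrite dp // ab lexx.
have p0 : p != 0 by apply/eqP => p0; move: dpb; rewrite p0 deriv0 horner0 ltxx.
have := @prev_rootP _ p a b; case; first by move/eqP; rewrite (negPf p0).
  move=> y _ /eqP py; rewrite in_itv /= => /andP[ay yb] nr.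
  have [] := @root_between_increasing_roots p y b yb pb dpb.
  - by rewrite (eqP py).
  - by apply: dp; rewrite ay ltW.
  by move=> v yvb pv; move: (nr v); rewrite in_itv /= yvb pv => /(_ isT).
move=> _ _ _ nr.
have [] := @root_between_increasing_roots p u b ub pb dpb pu0.
  by apply: dp; rewrite au ltW.
move=> v /andP[uv vb] pv; move: (nr v).
by rewrite in_itv /= vb pv (lt_trans au uv) => /(_ isT).
Qed.

Lemma rightmost_root_between p a b :
  a < b -> p.[a] < 0 -> (forall y, b <= y -> 0 < p.[y]) ->
  exists x, [/\ a < x, root p x & forall y, x < y -> 0 < p.[y]].
Proof.
move=> ab pa pb.
have [c cab pc] : {c | c \in `]a, b[ & root p c}.
  by apply: poly_ivtoo (ltW ab) _; rewrite pmulr_llt0 // pb.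
have p0 : p != 0 by apply/eqP => p0; move: pa; rewrite p0 horner0 ltxx.
have := @prev_rootP _ p a b; case; first by move/eqP; rewrite (negPf p0).
  move=> x _ px; rewrite in_itv /= => /andP[ax xb] nr.
  exists x; split => //; first by apply/eqP.
  move=> y xy; have [/pb//|yb] := leP b y.
  rewrite ltNge; apply/negP => py.
  have [] := @polyrcf.poly_ivt _ p y b (ltW yb).
    by rewrite pmulr_lle0 // pb.
  move=> z; rewrite in_itv /= => /andP[yz zb] pz.
  have zb' : z < b.
    rewrite lt_neqAle zb andbT; apply/eqP => zE.
    by move: (pb b (lexx b)); rewrite -zE (eqP pz) ltxx.
  by move: (nr z); rewrite in_itv /= zb' pz (lt_le_trans xy yz) => /(_ isT).
by move=> _ _ _ /(_ c cab); rewrite pc.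
Qed.

Lemma strictly_decreasing_poly p a b :
  a < b -> (forall c, a < c < b -> p^`().[c] < 0) -> p.[b] < p.[a].
Proof.
move=> ab dp; have [c] := poly_mvt p ab; rewrite in_itv /= => cab.
move=> e; rewrite -subr_lt0 e nmulr_rlt0 ?dp // subr_gt0 //.
Qed.

(** Final passage from [sonin] to [tau]: A and B will be the values at 1, whose ratio is that of the
    factors c and d. *)
Lemma ltr_normr_div (c d A B f g : R) :
  0 < d -> 0 < c -> 0 < A -> 0 < B -> d * B = c * A ->
  (d * g) ^+ 2 < (c * f) ^+ 2 -> `|g| / B < `|f| / A.
Proof.
move=> d0 c0 A0 B0 e.
rewrite -(real_normK (num_real (d * g))) -(real_normK (num_real (c * f))).
rewrite ltr_pXn2r ?nnegrE ?normr_ge0 // !normrM (gtr0_norm d0) (gtr0_norm c0).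
move=> lt_gf; rewrite ltr_pdivrMr // mulrAC ltr_pdivlMr //.
rewrite -(ltr_pM2l d0) [ltRHS]mulrCA e [ltRHS]mulrA (mulrC `|f|) mulrA.
by rewrite ltr_pM2r.
Qed.

End RealClosed.

(** * Relations between derivatives of neighbouring Chebyshev polynomials *)

Section Chebyshev.
Set Implicit Arguments. Unset Strict Implicit.
Variable R : realType.
Local Notation T := (chebT R).

Lemma chebTSS n : T n.+2 = 2%:P * 'X * T n.+1 - T n.
Proof. by []. Qed.

(* The pair is (U_n, U_(n+1)), Chebyshev polynomials of the second kind. *)
Lemma cheb_secondkind n :
  {U : {poly R} * {poly R} | [/\ (T n.+1)^`() = U.1 *+ n.+1,
     (T n.+2)^`() = U.2 *+ n.+2, U.2 = 'X * U.1 + T n.+1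
     & U.1 = 'X * U.2 - T n.+2]}.
Proof.
elim: n => [|n [[U V] /= [dT dT' VE UE]]].
  exists (1, 2%:P * 'X); rewrite /chebT /=; split.
  - by rewrite derivX.
  - rewrite !derivE; ring.
  - ring.
  - ring.
exists (V, 'X * V + T n.+2); rewrite (chebTSS n.+1).
move: (T n.+1) (T n.+2) dT dT' VE UE => P Q dP dQ VE UE.
cbn [fst snd]; split.
- exact: dQ.
- rewrite derivB !derivM derivC derivX dP dQ mul0r add0r mulr1 UE.
  ring.
- by [].
- rewrite [LHS]VE UE; ring.
Qed.

(** For k = 0 this is U_(n+1) = X U_n + T_(n+1). Each differentiation of the product with X adds one
    to the coefficient. *)
Lemma derivn_chebTS_up n k :
  (T n.+2)^`(k.+1) *+ n.+1 =
  ('X * (T n.+1)^`(k.+1) + (T n.+1)^`(k) *+ (n.+1 + k)) *+ n.+2.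
Proof.
elim: k => [|k IH].
  have [[U V] /= [dT dT' VE _]] := cheb_secondkind n.
  by rewrite dT dT' VE addn0; move: (T n.+1) => P; ring.
have := congr1 deriv IH; rewrite !derivMn -!derivnS => ->.
by rewrite derivD derivM derivX derivMn -!derivnS; ring.
Qed.

(** Likewise from U_n = X U_(n+1) - T_(n+2). The subtraction of k is done in the ring, since k may
    exceed n + 2. *)
Lemma derivn_chebTS_down n k :
  (T n.+1)^`(k.+1) *+ n.+2 =
  ('X * (T n.+2)^`(k.+1) - (n.+2%:R - k%:R) * (T n.+2)^`(k)) *+ n.+1.
Proof.
elim: k => [|k IH].
  have [[U V] /= [dT dT' _ UE]] := cheb_secondkind n.
  by rewrite dT dT' [in LHS]UE; move: (T n.+2) => P; ring.
have := congr1 deriv IH; rewrite !derivMn -!derivnS => ->.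
rewrite -(polyC_natr _ n.+2) -(polyC_natr _ k) -polyCB derivB !derivM derivX derivC.
by rewrite -!derivnS polyCB !polyC_natr; ring.
Qed.

Local Notation h n k x := ((T n)^`(k)).[x].

Lemma derivn_chebTS_up_eval n k x :
  n.+1%:R * h n.+2 k.+1 x =
  n.+2%:R * (x * h n.+1 k.+1 x + (n.+1%:R + k%:R) * h n.+1 k x).
Proof.
have := congr1 (horner^~ x) (derivn_chebTS_up n k).
by rewrite !hornerMn hornerD hornerM hornerX hornerMn mulr_natl => ->; ring.
Qed.

Lemma derivn_chebTS_down_eval n k x :
  n.+2%:R * h n.+1 k.+1 x =
  n.+1%:R * (x * h n.+2 k.+1 x - (n.+2%:R - k%:R) * h n.+2 k x).
Proof.
have := congr1 (horner^~ x) (derivn_chebTS_down n k).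
rewrite -(polyC_natr _ n.+2) -(polyC_natr _ k) -polyCB !hornerMn hornerD hornerN.
by rewrite !hornerM hornerX hornerC mulr_natl => ->; ring.
Qed.

(** Elimination of the derivative of the upper neighbour. The factor 1 - X^2 makes the first term
    vanish at 1, which yields the ratio of the normalising values. *)
Lemma derivn_chebTS_neighbour n k :
  n.+2%:R *: ((1 - 'X ^+ 2) * (T n.+1)^`(k.+1)) =
  (n.+2%:R * (n.+1%:R + k%:R)) *: ('X * (T n.+1)^`(k))
  - (n.+1%:R * (n.+2%:R - k%:R)) *: (T n.+2)^`(k).
Proof.
have /eqP := derivn_chebTS_up n k; rewrite -subr_eq0 => /eqP up.
have /eqP := derivn_chebTS_down n k; rewrite -subr_eq0 => /eqP dn.
rewrite -!mul_polyC !polyCM (polyCD n.+1%:R) (polyCB n.+2%:R) !polyC_natr.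
(* The difference of the two sides is that of [down] plus x times that of [up]. *)
apply/eqP; rewrite -subr_eq0; apply/eqP.
rewrite -[RHS](mulr0 'X) -[X in _ = _ * X]up -[RHS]add0r -[X in _ = X + _]dn.
move: (T n.+1)^`(_) (T n.+1)^`(k) (T n.+2)^`(_) (T n.+2)^`(k) => f' f g' g.
ring.
Qed.

Lemma derivn_chebT_recurrence n k :
  ((2 * n.+2 * n.+3 * n.+1)%:R) *: ('X * (T n.+2)^`(k)) =
  (n.+1%:R * n.+2%:R * (n.+3%:R - k%:R)) *: (T n.+3)^`(k)
  + (n.+2%:R * n.+3%:R * (n.+1%:R + k%:R)) *: (T n.+1)^`(k).
Proof.
have /eqP := derivn_chebTS_up n k; rewrite -subr_eq0 => /eqP up.
have /eqP := derivn_chebTS_down n k; rewrite -subr_eq0 => /eqP dn.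
have /eqP := derivn_chebTS_neighbour n.+1 k; rewrite -subr_eq0 => /eqP nb.
move: nb; rewrite -!mul_polyC !polyCM (polyCD n.+2%:R) (polyCD n.+1%:R).
rewrite (polyCB n.+3%:R) !polyC_natr => nb.
apply/eqP; rewrite -subr_eq0; apply/eqP.
(* The difference of the two sides is -(n+1) [nb] + (n+3) [up] + (n+3) X [dn], in which f' and g'
   cancel. *)
rewrite -[RHS](mulr0 (- n.+1%:R)) -[X in _ = _ * X]nb.
rewrite -[RHS]addr0 -[X in _ = _ + X](mulr0 n.+3%:R) -[X in _ = _ + _ * X]up.
rewrite -[RHS]addr0 -[X in _ = _ + X](mulr0 (n.+3%:R * 'X)).
rewrite -[X in _ = _ + _ * X]dn.
move: (T n.+1)^`(_) (T n.+1)^`(k) (T n.+2)^`(_) (T n.+2)^`(k) (T n.+3)^`(k).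
by move=> f' f g' g e; ring.
Qed.

(** * Positivity on [1, oo) and the derivatives of top order *)

Lemma chebT_ge1_nondecreasing n x : 1 <= x -> 0 < (T n).[x] <= (T n.+1).[x].
Proof.
move=> x1; elim: n => [|n /andP[p0 pq]].
  by rewrite /chebT /= hornerC hornerX ltr01.
rewrite (lt_le_trans p0 pq) /= chebTSS !hornerE; nra.
Qed.

Lemma derivn_chebT_eq0 n k : (n < k)%N -> (T n)^`(k) = 0.
Proof.
move=> nk; apply: derivn_poly0; apply: leq_trans nk.
have : (size (T n) <= n.+1)%N /\ (size (T n.+1) <= n.+2)%N; last by case.
elim: {k} n => [|n [pn qn]].
  by rewrite /chebT /= size_polyC size_polyX oner_neq0.
split=> //; rewrite chebTSS; apply: leq_trans (size_polyD _ _) _.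
rewrite geq_max size_polyN (leq_trans pn) ?andbT; last by rewrite ltnW.
rewrite -mulrA mul_polyC; apply: leq_trans (size_scale_leq _ _) _.
apply: leq_trans (size_polyMleq _ _) _.
by rewrite size_polyX /= ltnS.
Qed.

(** Induction on n through the upward relation, whose coefficients are nonnegative here. The weak
    bound for every k is carried along because the derivative of order k + 1 may already vanish when
    that of order k is positive. *)
Lemma derivn_chebT_ge1 n k x :
  1 <= x -> 0 <= h n k x /\ ((k <= n)%N -> 0 < h n k x).
Proof.
move=> x1; elim: n k => [|n IH] [|k].
- by rewrite derivn0 /chebT /= hornerC ltr01 ler01.
- by rewrite derivn_chebT_eq0 // horner0 lexx.
- have /andP[p0 pq] := chebT_ge1_nondecreasing n x1.
  by rewrite derivn0 ltW ?(lt_le_trans p0 pq).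
case: n IH => [|n] IH.
  case: k => [|k]; last by rewrite derivn_chebT_eq0 // horner0 lexx.
  have -> : T 1 = 'X by [].
  by rewrite derivn1 derivX hornerC ltr01 ler01.
have up := derivn_chebTS_up_eval n k x.
have [p0 _] := IH k.+1; have [q0 q1] := IH k.
have n1 : 0 < n.+1%:R :> R by rewrite ltr0n.
have n2 : 0 < n.+2%:R :> R by rewrite ltr0n.
have nk : 0 < n.+1%:R + k%:R :> R by rewrite -natrD ltr0n addSn.
have x0 : 0 <= x by rewrite (le_trans ler01).
split=> [|kn].
  rewrite -(pmulr_rge0 _ n1) up pmulr_rge0 //.
  by rewrite addr_ge0 // mulr_ge0 // ltW.
rewrite -(pmulr_rgt0 _ n1) up pmulr_rgt0 //.
by rewrite ltr_wpDl ?mulr_ge0 // mulr_gt0 // q1.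
Qed.

Lemma derivn_chebT_gt0 n k x : (k <= n)%N -> 1 <= x -> 0 < h n k x.
Proof. by move=> kn x1; have [_ ->] := derivn_chebT_ge1 n k x1. Qed.

Lemma derivn_chebT_diag_gt0 n x : 0 < h n n x.
Proof.
case: n => [|n]; first by rewrite derivn0 /chebT /= hornerC ltr01.
elim: n => [|n IH]; first last.
  have n1 : 0 < n.+1%:R :> R by rewrite ltr0n.
  rewrite -(pmulr_rgt0 _ n1) derivn_chebTS_up_eval derivn_chebT_eq0 // horner0.
  by rewrite mulr0 add0r !mulr_gt0 ?IH ?ltr0n // -natrD ltr0n.
by rewrite derivn1 (_ : T 1 = 'X) // derivX hornerC ltr01.
Qed.

(** Start of the induction on zeros: the left side of the downward relation vanishes by degree, so
    the only zero is 0. *)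
Lemma derivn_chebTS_diag k x : h k.+2 k.+1 x = x * h k.+2 k.+2 x.
Proof.
have := derivn_chebTS_down_eval k k.+1 x.
rewrite derivn_chebT_eq0 // horner0 mulr0 -natrB // subSnn mul1r.
move=> /esym/eqP; rewrite mulf_eq0 pnatr_eq0 /= subr_eq0.
by move/eqP.
Qed.

(** * The Wronskian and the interlacing of rightmost zeros *)

Lemma derivn_chebT_recurrence_eval n k x :
  (2 * n.+2 * n.+3 * n.+1)%:R * (x * h n.+2 k x) =
  (n.+1%:R * n.+2%:R * (n.+3%:R - k%:R)) * h n.+3 k x
  + (n.+2%:R * n.+3%:R * (n.+1%:R + k%:R)) * h n.+1 k x.
Proof.
have := congr1 (horner^~ x) (derivn_chebT_recurrence n k).
by rewrite hornerD !hornerZ hornerM hornerX.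
Qed.

Lemma derivn_chebT_recurrence_deriv n k x :
  (2 * n.+2 * n.+3 * n.+1)%:R * (h n.+2 k x + x * h n.+2 k.+1 x) =
  (n.+1%:R * n.+2%:R * (n.+3%:R - k%:R)) * h n.+3 k.+1 x
  + (n.+2%:R * n.+3%:R * (n.+1%:R + k%:R)) * h n.+1 k.+1 x.
Proof.
have := congr1 (fun p => p^`().[x]) (derivn_chebT_recurrence n k).
rewrite derivD !derivZ derivM derivX mul1r -!derivnS.
by rewrite hornerD !hornerZ hornerD hornerM hornerX.
Qed.

(** A Christoffel-Darboux argument: the recurrence gives b W_(n+1) = a g^2 + c W_n with a, b, c > 0.
    At the start n = k one product vanishes by degree. *)
Lemma derivn_chebT_wronskian_gt0 n k x : (k <= n)%N ->
  0 < h n.+2 k.+2 x * h n.+1 k.+1 x - h n.+2 k.+1 x * h n.+1 k.+2 x.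
Proof.
elim: n => [|n IH].
  rewrite leqn0 => /eqP->.
  rewrite (@derivn_chebT_eq0 1 2) // horner0 mulr0 subr0.
  by rewrite mulr_gt0 ?derivn_chebT_diag_gt0.
rewrite leq_eqVlt => /orP[/eqP->|].
  rewrite (@derivn_chebT_eq0 n.+2 n.+3) // horner0 mulr0 subr0.
  by rewrite mulr_gt0 ?derivn_chebT_diag_gt0.
rewrite ltnS => kn; have {IH}W := IH kn.
have := derivn_chebT_recurrence_eval n k.+1 x.
have := derivn_chebT_recurrence_deriv n k.+1 x.
set a := (2 * _ * _ * _)%:R; set b := _ * (n.+3%:R - _).
set c := _ * (n.+1%:R + _) => e' e.
have a0 : 0 < a by rewrite ltr0n.
have b0 : 0 < b.
  by rewrite !mulr_gt0 ?ltr0n // subr_gt0 ltr_nat !ltnS (leq_trans kn) // leqW.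
have c0 : 0 < c by rewrite !mulr_gt0 ?ltr0n // -natrD ltr0n.
rewrite -(pmulr_rgt0 _ b0); move: W e e'.
move: (h n.+1 k.+1 x) (h n.+1 k.+2 x) (h n.+2 k.+1 x) (h n.+2 k.+2 x).
move: (h n.+3 k.+1 x) (h n.+3 k.+2 x) => p p' f f' g g' W e e'.
have -> : b * (p' * g - p * g') = a * g ^+ 2 + c * (g' * f - g * f').
  have -> : b * (p' * g - p * g') = b * p' * g - b * p * g' by ring.
  have -> : b * p' = a * (g + x * g') - c * f' by rewrite e' addrK.
  have -> : b * p = a * (x * g) - c * f by rewrite e addrK.
  ring.
by rewrite ltr_wpDl ?(mulr_gt0 c0 W) // mulr_ge0 ?sqr_ge0 // ltW.
Qed.

(** Where the middle term of the recurrence vanishes, the outer two have opposite signs. *)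
Lemma derivn_chebT_lt0_at_root n k x : (k <= n)%N ->
  root (T n.+2)^`(k.+1) x -> 0 < h n.+1 k.+1 x -> h n.+3 k.+1 x < 0.
Proof.
move=> kn /eqP r p; have := derivn_chebT_recurrence_eval n k.+1 x.
rewrite r !mulr0 => e.
have b0 : 0 < n.+1%:R * n.+2%:R * (n.+3%:R - k.+1%:R) :> R.
  by rewrite !mulr_gt0 ?ltr0n // subr_gt0 ltr_nat !ltnS (leq_trans kn) // leqW.
have c0 : 0 < n.+2%:R * n.+3%:R * (n.+1%:R + k.+1%:R) :> R.
  by rewrite !mulr_gt0 ?ltr0n // -natrD ltr0n.
rewrite -(pmulr_rlt0 _ b0); have := mulr_gt0 c0 p; lra.
Qed.

(** Positivity of the preceding polynomial at x is the induction invariant. It makes the next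
    polynomial negative at x; being positive from 1 on, that one has its rightmost zero beyond x,
    where the current polynomial is positive again. *)
Lemma exists_rightmost_root n k : (k <= n)%N ->
  exists x, [/\ root (T n.+2)^`(k.+1) x, 0 < h n.+1 k.+1 x &
                forall y, x < y -> 0 < h n.+2 k.+1 y].
Proof.
move=> kn; rewrite -(subnK kn); elim: (n - k)%N => [|m].
  exists 0; rewrite add0n; split.
  - by rewrite rootE derivn_chebTS_diag mul0r.
  - exact: derivn_chebT_diag_gt0.
  - by move=> y y0; rewrite derivn_chebTS_diag mulr_gt0 ?derivn_chebT_diag_gt0.
have kmk : (k <= m + k)%N by rewrite leq_addl.
rewrite addSn; move: (m + k)%N kmk => l kl [x [rx px xP]].
have neg := derivn_chebT_lt0_at_root kl rx px.
have pos y : 1 <= y -> 0 < h l.+3 k.+1 y.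
  by apply: derivn_chebT_gt0; rewrite !ltnS ltnW // ltnS ltnW // ltnS.
have x1 : x < 1 by rewrite ltNge; apply/negP => /pos; rewrite ltNge ltW.
have [z [xz rz zP]] := rightmost_root_between x1 neg pos.
by exists z; split => //; apply: xP.
Qed.

Lemma omegaP n k : (k <= n)%N ->
  [/\ root (T n.+2)^`(k.+1) (omega R n.+2 k), 0 < h n.+1 k.+1 (omega R n.+2 k) &
     forall y, omega R n.+2 k < y -> 0 < h n.+2 k.+1 y].
Proof.
move=> kn; have [x [rx px xP]] := exists_rightmost_root kn.
have rmx : is_rightmost_root (T n.+2)^`(k.+1) x.
  split=> // y /eqP ry; rewrite leNgt; apply/negP => /xP.
  by rewrite ry ltxx.
have -> // : omega R n.+2 k = x.
apply: xget_unique => // y [ry yP].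
by apply/eqP; rewrite eq_le yP // andbT; case: rmx => _ ->.
Qed.

Lemma omega_lt n k : (k <= n)%N -> omega R n.+2 k < omega R n.+3 k.
Proof.
move=> kn; have [r p _] := omegaP kn; have [/eqP r' _ P] := omegaP (leqW kn).
have neg := derivn_chebT_lt0_at_root kn r p.
rewrite ltNge le_eqVlt; apply/negP => /orP[/eqP e|/P].
  by move: neg; rewrite -e r' ltxx.
by rewrite ltNge ltW.
Qed.

Lemma derivn_chebT_lt0_between n k x : (k <= n)%N ->
  omega R n.+2 k < x < omega R n.+3 k -> h n.+3 k.+1 x < 0.
Proof.
move=> kn; have [_ _ P] := omegaP kn; have [r _ _] := omegaP (leqW kn).
apply: lt0_left_of_increasing_root r _ x => z /andP[/P pz _] /eqP rz.
(* At a zero z of g' the Wronskian is g''(z) f'(z), and f'(z) > 0. *)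
have := derivn_chebT_wronskian_gt0 z (leqW kn).
by rewrite rz mul0r subr0 -derivnS pmulr_lgt0.
Qed.

(* Up to a constant factor, the Sonin function of the ultraspherical equation
   satisfied by [T_n^(k)]. *)
Definition sonin n k : {poly R} :=
  (n%:R + k%:R) ^+ 2 *: (T n)^`(k) ^+ 2 + (1 - 'X ^+ 2) * (T n)^`(k.+1) ^+ 2.

Lemma horner_sonin n k x : (sonin n k).[x] =
  (n%:R + k%:R) ^+ 2 * h n k x ^+ 2 + (1 - x ^+ 2) * h n k.+1 x ^+ 2.
Proof.
rewrite /sonin !(hornerD, hornerN, hornerZ, hornerM, hornerX, hornerC); ring.
Qed.

Lemma deriv_sonin n k x :
  n.+2%:R * (sonin n.+1 k)^`().[x] =
  4 * k%:R * n.+1%:R * h n.+1 k.+1 x * h n.+2 k.+1 x.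
Proof.
have dq : (1 - 'X ^+ 2)^`() = - ('X + 'X) :> {poly R}.
  by rewrite derivB (derivC 1) sub0r expr2 derivM derivX mul1r mulr1.
have := congr1 (fun p => p^`().[x]) (derivn_chebTS_neighbour n k).
rewrite derivB !derivZ !derivM dq derivX -!derivnS.
rewrite !(hornerD, hornerN, hornerZ, hornerM, hornerX, hornerC).
have -> : (sonin n.+1 k)^`().[x] = 2 * (n.+1%:R + k%:R) ^+ 2 * h n.+1 k x
    * h n.+1 k.+1 x - 2 * x * h n.+1 k.+1 x ^+ 2
    + 2 * (1 - x ^+ 2) * h n.+1 k.+1 x * h n.+1 k.+2 x.
  rewrite /sonin derivD derivZ !(expr2 _^`(_)) !derivM dq -!derivnS.
  rewrite !(hornerD, hornerN, hornerZ, hornerM, hornerX, hornerC).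
  ring.
have := derivn_chebTS_up_eval n k x.
move: (h n.+1 k x) (h n.+1 k.+1 x) (h n.+1 k.+2 x) (h n.+2 k x) (h n.+2 k.+1 x).
move=> f f' f'' g g'; rewrite -(natr1 n.+1).
move: n.+1%:R k%:R => N K up nb.
(* The differentiated neighbour relation trades f'' for g'. After x f' is eliminated by [up], all
   multiples of f cancel and g' keeps the coefficient 2 K N. *)
have e : (N + 1) * ((1 - x * x) * f'' - 2 * x * f') =
    (N + 1) * (N + K) * (f + x * f') - N * (N + 1 - K) * g' by lra.
have -> : (N + 1) * (2 * (N + K) ^+ 2 * f * f' - 2 * x * f' ^+ 2
    + 2 * (1 - x ^+ 2) * f' * f'') =
  2 * f' * ((N + 1) * (N + K) ^+ 2 * f + (N + 1) * x * f'
    + (N + 1) * ((1 - x * x) * f'' - 2 * x * f')) by ring.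
rewrite e.
have -> : (N + 1) * x * f' = N * g' - (N + 1) * (N + K) * f by lra.
have -> : (N + 1) * (N + K) * (f + x * f') =
  (N + 1) * (N + K) * f + (N + K) * (N * g' - (N + 1) * (N + K) * f).
  rewrite up; ring.
ring.
Qed.

Lemma sonin_lt n k : (0 < k <= n)%N ->
  (sonin n.+2 k).[omega R n.+3 k] < (sonin n.+2 k).[omega R n.+2 k].
Proof.
case/andP=> k0 kn; apply: strictly_decreasing_poly (omega_lt kn) _ => x xP.
have g0 := derivn_chebT_lt0_between kn xP.
have [_ _ /(_ x)] := omegaP kn; case/andP: xP => -> _ /(_ isT) f0.
have n3 : 0 < n.+3%:R :> R by rewrite ltr0n.
(* The factor k in the derivative is where k > 0 enters. *)
by rewrite -(pmulr_rlt0 _ n3) deriv_sonin nmulr_llt0 // !mulr_gt0 ?ltr0n.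
Qed.

Lemma sonin_root n k x : root (T n)^`(k.+1) x ->
  (sonin n k).[x] = ((n%:R + k%:R) * h n k x) ^+ 2.
Proof.
move=> /eqP r; rewrite horner_sonin r.
by rewrite expr0n mulr0 addr0 exprMn.
Qed.

(** At a zero of g' the upward relation turns (n+1+k) f into -x f', so [sonin] collapses to f'^2.
    The downward relation then expresses f' through g. *)
Lemma sonin_root_next n k x : root (T n.+2)^`(k.+1) x ->
  n.+2%:R ^+ 2 * (sonin n.+1 k).[x] =
  (n.+1%:R * (n.+2%:R - k%:R) * h n.+2 k x) ^+ 2.
Proof.
move=> /eqP r; have := derivn_chebTS_down_eval n k x.
have := derivn_chebTS_up_eval n k x.
rewrite r mulr0 => /esym/eqP; rewrite mulf_eq0 pnatr_eq0 /= addr_eq0.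
rewrite mulr0 sub0r mulrN => /eqP up dn.
rewrite horner_sonin.
have -> : (n.+1%:R + k%:R) ^+ 2 * h n.+1 k x ^+ 2 = (x * h n.+1 k.+1 x) ^+ 2.
  by rewrite -exprMn up sqrrN.
have -> : (n.+1%:R * (n.+2%:R - k%:R) * h n.+2 k x) ^+ 2 =
  (n.+2%:R * h n.+1 k.+1 x) ^+ 2 by rewrite dn mulrA sqrrN.
ring.
Qed.

Lemma derivn_chebTS_at1 n k :
  n.+1%:R * (n.+2%:R - k%:R) * h n.+2 k 1 =
  n.+2%:R * (n.+1%:R + k%:R) * h n.+1 k 1.
Proof.
have := congr1 (horner^~ 1) (derivn_chebTS_neighbour n k).
rewrite !(hornerD, hornerN, hornerZ, hornerM, hornerX, hornerC).
rewrite mulr1 subrr mul0r mulr0 mul1r.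
by move=> /esym/eqP; rewrite subr_eq0 => /eqP.
Qed.

Lemma tau_lt n k : (0 < k <= n)%N -> tau R n.+3 k < tau R n.+2 k.
Proof.
move=> kn; have := sonin_lt kn; case/andP: kn => k0 kn.
have [r _ _] := omegaP kn; have [r' _ _] := omegaP (leqW kn).
have n3 : 0 < n.+3%:R :> R by rewrite ltr0n.
rewrite -(ltr_pM2l (exprn_gt0 2 n3)) sonin_root_next // sonin_root // -exprMn.
rewrite [in ltRHS]mulrA.
have c0 : 0 < n.+2%:R + k%:R :> R by rewrite -natrD ltr0n.
have d0 : 0 < n.+3%:R - k%:R :> R.
  by rewrite subr_gt0 ltr_nat !ltnS leqW // leqW.
have A0 : 0 < h n.+2 k 1 by rewrite derivn_chebT_gt0 // leqW // leqW.
have B0 : 0 < h n.+3 k 1 by rewrite derivn_chebT_gt0 // leqW // leqW // leqW.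
(* Here d = (n+2)(n+3-k) and c = (n+3)(n+2+k), the factors of the two [sonin] values after scaling
   by (n+3)^2. *)
apply: (ltr_normr_div _ _ A0 B0 (derivn_chebTS_at1 n.+1 k)).
- by rewrite mulr_gt0 ?ltr0n.
- by rewrite mulr_gt0.
Qed.

End Chebyshev.

Theorem theorem1p1 (R : realType) (k : nat) (hk : (1 <= k)%N) :
  (forall n : nat, (k + 2 <= n)%N -> tau R n.+1 k < tau R n k) /\
  (forall m n : nat, (2 <= m)%N -> (k + m <= n)%N -> tau R n k <= tau R (k + m) k).
Proof.
have decr n : (k + 2 <= n)%N -> tau R n.+1 k < tau R n k.
  case: n => [|[|n]]; rewrite ?addn2 // !ltnS => kn.
  by apply: tau_lt; rewrite hk.
split=> // m n m2 /subnK<-.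
elim: (n - (k + m))%N => [|i IH]; first by rewrite add0n.
rewrite addSn; apply: le_trans IH; apply/ltW/decr.
by rewrite (leq_trans _ (leq_addl _ _)) // leq_add2l.
Qed.
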